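(* Let $\mathbf P$ be a finite set with partial order $<$, and let $\Delta:\bigoplus_{p\in\mathbf P}C(p)\to\bigoplus_{p\in\mathbf P}C(p)$ and $\Delta':\bigoplus_{p\in\mathbf P}C'(p)\to\bigoplus_{p\in\mathbf P}C'(p)$ be connection matrices of graded module braids $\mathcal G$ and $\mathcal G'$ over $<$, respectively. Assume that $\Delta$ and $\Delta'$ are trivial (i.e. $\Delta=0$, $\Delta'=0$, so that $\mathcal H\Delta(\mathbf I)=\bigoplus_{p\in\mathbf I}C(p)$ and $\mathcal H\Delta'(\mathbf I)=\bigoplus_{p\in\mathbf I}C'(p)$ for every interval $\mathbf I$), and that $\Phi:\mathcal H\Delta\to\mathcal G$ and $\Phi':\mathcal H\Delta'\to\mathcal G'$ are graded module braid isomorphisms. If $\Theta:\mathcal G\to\mathcal G'$ is an isomorphism of graded module braids, then $$T=\Phi'(\mathbf P)^{-1}\circ\Theta(\mathbf P)\circ\Phi(\mathbf P):\bigoplus_{p\in\mathbf P}C(p)\to\bigoplus_{p\in\mathbf P}C'(p)$$ is a transition matrix for $\Delta$ and $\Delta'$.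
   Context: Intervals. $\mathbf P$ is a finite set with a (strict) partial order $<$. An interval is a subset $\mathbf I\subseteq\mathbf P$ such that $p,q\in\mathbf I$ and $p<r<q$ imply $r\in\mathbf I$; $\mathbf I(<)$ is the set of intervals. An adjacent $n$-tuple of intervals is an ordered collection $(\mathbf I_1,\dots,\mathbf I_n)$ of mutually disjoint nonempty intervals whose union is an interval and such that $\pi\in\mathbf I_j$, $\pi'\in\mathbf I_k$, $j<k$ imply $\pi'\not<\pi$; $\mathbf I_n(<)$ is the set of these. For $(\mathbf I,\mathbf J)\in\mathbf I_2(<)$ write $\mathbf{IJ}=\mathbf I\cup\mathbf J$. Disjoint $\mathbf I,\mathbf J$ are noncomparable if no element of $\mathbf I$ is comparable to an element of $\mathbf J$. Graded module braids. A graded module braid $\mathcal G$ over $<$ consists of a graded module $G(\mathbf I)$ for each $\mathbf I\in\mathbf I(<)$ and, for each $(\mathbf I,\mathbf J)\in\mathbf I_2(<)$, maps $i(\mathbf I,\mathbf{IJ}):G(\mathbf I)\to G(\mathbf{IJ})$ and $p(\mathbf{IJ},\mathbf J):G(\mathbf{IJ})\to G(\mathbf J)$ of degree $0$ and $\partial(\mathbf J,\mathbf I):G(\mathbf J)\to G(\mathbf I)$ lowering degree by $1$, such that $\cdots\to G(\mathbf I)\xrightarrow{i}G(\mathbf{IJ})\xrightarrow{p}G(\mathbf J)\xrightarrow{\partial}G(\mathbf I)\to\cdots$ is exact; $p(\mathbf{JI},\mathbf I)\,i(\mathbf I,\mathbf{IJ})=\mathrm{id}$ if $\mathbf I,\mathbf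 J$ are noncomparable; and for $(\mathbf I,\mathbf J,\mathbf K)\in\mathbf I_3(<)$ the standard braid diagram formed by the four long exact sequences of $(\mathbf I,\mathbf J)$, $(\mathbf J,\mathbf K)$, $(\mathbf I,\mathbf{JK})$, $(\mathbf{IJ},\mathbf K)$ commutes. A map $\theta:\mathcal G\to\mathcal G'$ is a collection of degree-$0$ homomorphisms $\theta(\mathbf I):G(\mathbf I)\to G'(\mathbf I)$ commuting with all $i,p,\partial$; it is an isomorphism if every $\theta(\mathbf I)$ is. Matrices. A map $T:\bigoplus C(p)\to\bigoplus C'(p)$ is a matrix with entries $T(p,q):C(q)\to C'(p)$; $T(\mathbf I)$ is the submatrix with indices in $\mathbf I$. $T$ is $<$-upper triangular if $T(p,q)\neq0$ implies $p=q$ or $p<q$. A $<$-upper triangular boundary map $\Delta$ on $\bigoplus C(p)$ (degree $-1$, $\Delta^2=0$) generates a chain complex braid $\mathcal C\Delta=\{(C(\mathbf I),\Delta(\mathbf I))\}$, $C(\mathbf I)=\bigoplus_{p\in\mathbf I}C(p)$, with the obvious inclusions $i$ and projections $p$; its homology is a graded module braid $\mathcal H\Delta$. $\Delta$ is a connection matrix of $\mathcal G$ if $\mathcal H\Delta$ is isomorphic to $\mathcal G$ and $C(p)\cong G(\{p\})$ for each $p$. Transition matrices. A matrix $T:\bigoplus C(p)\to\bigoplus C'(p)$ is a ($0$-degree) transition matrix for connection matrices $\Delta$ of $\mathcal G$ and $\Delta'$ of $\mathcal G'$ if the collection $\{T(\mathbf I)\}_{\mathbf I\in\mathbf I(<)}$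 consists of degree-$0$ chain maps $\mathcal C\Delta(\mathbf I)\to\mathcal C\Delta'(\mathbf I)$ commuting with all $i$ and $p$, and covers some isomorphism $\theta:\mathcal G\to\mathcal G'$: there are graded module braid isomorphisms $\Phi:\mathcal H\Delta\to\mathcal G$, $\Phi':\mathcal H\Delta'\to\mathcal G'$ with $\Phi'(\mathbf I)\circ T_*(\mathbf I)=\theta(\mathbf I)\circ\Phi(\mathbf I)$ for all $\mathbf I\in\mathbf I(<)$, where $T_*(\mathbf I)$ is the map induced on homology. *)

(* Defs.v *)
From HB Require Import structures.
From mathcomp Require Import all_boot all_order all_algebra.
From mathcomp Require Import boolp generic_quotient ring_quotient.
Local Open Scope quotient_scope.

Set Implicit Arguments.
Unset Strict Implicit.
Unset Printing Implicit Defensive.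

Import Order.TTheory GRing.Theory.
Local Open Scope ring_scope.

Section DependentFinFun.
Variable aT : finType.

Section Zmod.
Variable rT : aT -> zmodType.
Local Notation fT := {dffun forall x : aT, rT x}.

Definition dffun_add (f g : fT) : fT := [ffun x => f x + g x].
Definition dffun_zero : fT := [ffun x => 0].
Definition dffun_opp (f : fT) : fT := [ffun x => - f x].

Fact dffun_addA : associative dffun_add.
Proof. by move=> f g h; apply/ffunP => x; rewrite !ffunE addrA. Qed.
Fact dffun_addC : commutative dffun_add.
Proof. by move=> f g; apply/ffunP => x; rewrite !ffunE addrC. Qed.
Fact dffun_add0 : left_id dffun_zero dffun_add.
Proof. by move=> f; apply/ffunP => x; rewrite !ffunE add0r. Qed.
Fact dffun_addN : left_inverse dffun_zero dffun_opp dffun_add.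
Proof. by move=> f; apply/ffunP => x; rewrite !ffunE addNr. Qed.

HB.instance Definition _ := GRing.isZmodule.Build fT
  dffun_addA dffun_addC dffun_add0 dffun_addN.
End Zmod.

Section Lmod.
Variables (R : pzRingType) (rT : aT -> lmodType R).
Local Notation fT := {dffun forall x : aT, rT x}.

Definition dffun_scale (a : R) (f : fT) : fT := [ffun x => a *: f x].

Fact dffun_scaleA a b f :
  dffun_scale a (dffun_scale b f) = dffun_scale (a * b) f.
Proof. by apply/ffunP => x; rewrite !ffunE scalerA. Qed.
Fact dffun_scale1 : left_id 1 dffun_scale.
Proof. by move=> f; apply/ffunP => x; rewrite !ffunE scale1r. Qed.
Fact dffun_scaleDr : right_distributive dffun_scale +%R.
Proof. by move=> a f g; apply/ffunP => x; rewrite !ffunE scalerDr. Qed.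
Fact dffun_scaleDl f : {morph dffun_scale^~ f : a b / a + b}.
Proof. by move=> a b; apply/ffunP => x; rewrite !ffunE scalerDl. Qed.

HB.instance Definition _ := GRing.Zmodule_isLmodule.Build R fT
  dffun_scaleA dffun_scale1 dffun_scaleDr dffun_scaleDl.
End Lmod.
End DependentFinFun.

Section LmodQuotient.
Variables (R : pzRingType) (V : lmodType R) (S : {pred V}).
Hypothesis S_closed : submod_closed S.

Let S_zmod : zmodClosed V := HB.pack S
  (GRing.isZmodClosed.Build V S (GRing.submod_closedB S_closed)).

Definition lquot := Quotient.quot S_zmod.
HB.instance Definition _ := GRing.Zmodule.on lquot.

Definition lpi (x : V) : lquot := \pi_(Quotient.quot S_zmod) x.
Definition lrepr (x : lquot) : V := repr (x : Quotient.quot S_zmod).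

Lemma lreprK : cancel lrepr lpi.
Proof. by move=> x; rewrite /lpi /lrepr reprK. Qed.

Fact lpi_is_zmod_morphism : zmod_morphism lpi.
Proof. by move=> x y; rewrite /lpi raddfB. Qed.

Lemma lpi_eq x y : lpi x = lpi y <-> x - y \in S.
Proof. by rewrite (Quotient.idealrBE S_zmod); split => [/eqP|/eqP]. Qed.

Lemma lquot_closedZ a x : x \in S -> a *: x \in S.
Proof. by move=> xS; rewrite -[_ *: x]addr0 S_closed.2 ?S_closed.1. Qed.

Definition lscale (a : R) (x : lquot) : lquot := lpi (a *: lrepr x).

Lemma lscale_pi a x : lscale a (lpi x) = lpi (a *: x).
Proof.
apply/lpi_eq; rewrite -scalerBr; apply: lquot_closedZ.
by apply/lpi_eq; rewrite lreprK.
Qed.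

Lemma lpiD x y : lpi (x + y) = lpi x + lpi y.
Proof. by rewrite /lpi raddfD. Qed.

Fact lscaleA a b x : lscale a (lscale b x) = lscale (a * b) x.
Proof. by rewrite -[x]lreprK !lscale_pi scalerA. Qed.
Fact lscale1 : left_id 1 lscale.
Proof. by move=> x; rewrite -[x]lreprK lscale_pi scale1r. Qed.
Fact lscaleDr : right_distributive lscale +%R.
Proof.
move=> a x y; rewrite -[x]lreprK -[y]lreprK -lpiD !lscale_pi.
by rewrite scalerDr lpiD.
Qed.
Fact lscaleDl x : {morph lscale^~ x : a b / a + b}.
Proof.
by move=> a b; rewrite -[x]lreprK !lscale_pi scalerDl lpiD.
Qed.

HB.instance Definition _ := GRing.Zmodule_isLmodule.Build R lquot
  lscaleA lscale1 lscaleDr lscaleDl.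

Fact lpi_is_scalable : scalable lpi.
Proof. by move=> a x; rewrite -lscale_pi. Qed.

HB.instance Definition _ := GRing.isZmodMorphism.Build V lquot lpi
  lpi_is_zmod_morphism.
HB.instance Definition _ := GRing.isScalable.Build R V lquot *:%R lpi
  lpi_is_scalable.
End LmodQuotient.

Section LinearInverse.
Variables (R : pzRingType) (U V : lmodType R) (f : {linear U -> V}).
Hypothesis f_bij : bijective f.

Fact linv_subproof y : exists x, f x == y.
Proof. by have [g _ gK] := f_bij; exists (g y); rewrite gK. Qed.

Definition linv (y : V) : U := xchoose (linv_subproof y).

Lemma linvK : cancel linv f.
Proof. by move=> y; apply/eqP; exact: (xchooseP (linv_subproof y)). Qed.

Lemma linvKV : cancel f linv.
Proof. by move=> x; apply: (bij_inj f_bij); rewrite linvK. Qed.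

Fact linv_is_linear : linear linv.
Proof.
by move=> a x y; apply: (bij_inj f_bij); rewrite linearP !linvK.
Qed.

HB.instance Definition _ := GRing.isLinear.Build R V U *:%R linv linv_is_linear.
End LinearInverse.

(* The homology at V of U --f--> V --g--> W: the cycles, ker g, modulo those of
   them that lie in the image of f. Image membership is not decidable over an
   arbitrary ring, hence the classical asbool. *)
Section Homology.
Variables (R : pzRingType) (U V W : lmodType R).
Variables (f : {linear U -> V}) (g : {linear V -> W}).

Definition ker_pred : {pred V} := fun x => g x == 0.

Fact ker_pred_closed : submod_closed ker_pred.
Proof.
split=> [|a x y]; rewrite !unfold_in /= ?linear0 //.
by move=> /eqP gx /eqP gy; rewrite linearP gx gy scaler0 addr0.
Qed.
HB.instance Definition _ := GRing.isSubmodClosed.Build R V ker_pred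
  ker_pred_closed.

Record cycle := Cycle { cycle_val :> V; _ : cycle_val \in ker_pred }.
HB.instance Definition _ := [isSub for cycle_val].
HB.instance Definition _ := [Choice of cycle by <:].
HB.instance Definition _ := [SubChoice_isSubLmodule of cycle by <:].

Definition boundary_pred : {pred cycle} := fun z =>
  `[< exists u, f u = cycle_val z >].

Fact boundary_pred_closed : submod_closed boundary_pred.
Proof.
split=> [|a x y]; rewrite !unfold_in /=.
  by apply/asboolP; exists 0; rewrite linear0.
move=> /asboolP[u fu] /asboolP[v fv]; apply/asboolP.
by exists (a *: u + v); rewrite linearP fu fv.
Qed.

Definition homology : lmodType R := lquot boundary_pred_closed.

Definition hclass : {linear cycle -> homology} :=
  @lpi R cycle _ boundary_pred_closed.

Lemma cycleP (z : cycle) : g (cycle_val z) = 0.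
Proof. exact/eqP/(valP z). Qed.

Definition mk_cycle x (gx : g x = 0) : cycle := Cycle (introT eqP gx).

Lemma hclass_eq0 (z : cycle) : hclass z = 0 <-> exists u, f u = cycle_val z.
Proof.
rewrite -(linear0 hclass) /hclass /=.
split=> [/lpi_eq|h]; [|apply/lpi_eq]; rewrite subr0 unfold_in.
  by move/asboolP.
exact/asboolP.
Qed.

Lemma hclass_surj (h : homology) : exists z, hclass z = h.
Proof. by exists (lrepr h); exact: lreprK. Qed.
End Homology.

Section HomologyMap.
Variables (R : pzRingType) (U V W U' V' W' : lmodType R).
Variables (f : {linear U -> V}) (g : {linear V -> W}).
Variables (f' : {linear U' -> V'}) (g' : {linear V' -> W'}).
Variable h : {linear V -> V'}.
Hypothesis hZ : forall x, g x = 0 -> g' (h x) = 0.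
Hypothesis hB : forall u, exists u', f' u' = h (f u).

Definition cycle_map (z : cycle g) : cycle g' := mk_cycle (hZ (cycleP z)).

Fact cycle_map_is_linear : linear cycle_map.
Proof. by move=> a x y; apply: val_inj; rewrite /= linearP. Qed.
HB.instance Definition _ := GRing.isLinear.Build R (cycle g) (cycle g') *:%R
  cycle_map cycle_map_is_linear.

Definition homology_map_fun (x : homology f g) : homology f' g' :=
  hclass f' g' (cycle_map (lrepr x)).

Lemma homology_map_fun_class z :
  homology_map_fun (hclass f g z) = hclass f' g' (cycle_map z).
Proof.
apply/eqP; rewrite -subr_eq0 -!linearB; apply/eqP/hclass_eq0 => /=.
have /hclass_eq0[u fu] : hclass f g (lrepr (hclass f g z) - z) = 0.
  by rewrite linearB /= lreprK subrr.
have [u' fu'] := hB u; exists u'.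
by rewrite fu' fu /= linearB.
Qed.

Fact homology_map_is_linear : linear homology_map_fun.
Proof.
move=> a x y; have [z <-] := hclass_surj x; have [t <-] := hclass_surj y.
by rewrite -linearP !homology_map_fun_class linearP linearP.
Qed.
HB.instance Definition _ := GRing.isLinear.Build R (homology f g)
  (homology f' g') *:%R homology_map_fun homology_map_is_linear.

Definition homology_map : {linear homology f g -> homology f' g'} :=
  homology_map_fun.

Lemma homology_mapE z :
  homology_map (hclass f g z) = hclass f' g' (cycle_map z).
Proof. exact: homology_map_fun_class. Qed.
End HomologyMap.

Section Intervals.
Context {d : Order.disp_t} (P : finPOrderType d).

Definition is_po_interval (I : {set P}) : bool :=
  [forall p in I, forall q in I, forall r, (p < r < q)%O ==> (r \in I)].

Record po_interval := PoInterval {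
  po_set :> {set P};
  _ : is_po_interval po_set
}.
HB.instance Definition _ := [isSub for po_set].
HB.instance Definition _ := [Finite of po_interval by <:].

Lemma po_intervalP (I : po_interval) p q r :
  p \in po_set I -> q \in po_set I -> (p < r < q)%O -> r \in po_set I.
Proof.
move=> pI qI; have /forallP/(_ p) := valP I.
by move/implyP/(_ pI)/forallP/(_ q)/implyP/(_ qI)/forallP/(_ r)/implyP; apply.
Qed.

Lemma is_po_intervalT : is_po_interval [set: P].
Proof.
do 2![apply/forallP => ?; apply/implyP => _]; apply/forallP => ?.
by rewrite inE implybT.
Qed.

Lemma is_po_interval1 p : is_po_interval [set p].
Proof.
apply/forallP => a; apply/implyP => /set1P ->.
apply/forallP => b; apply/implyP => /set1P ->.
apply/forallP => r; apply/implyP => /andP[pr rp].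
by have := lt_trans pr rp; rewrite ltxx.
Qed.

Definition po_full : po_interval := PoInterval is_po_intervalT.
Definition po_single p : po_interval := PoInterval (is_po_interval1 p).

Definition precedes (I J : {set P}) : bool :=
  [disjoint I & J] && [forall p in I, forall q in J, ~~ (q < p)%O].

Definition adjacent (s : seq {set P}) : bool :=
  [&& all (fun I => (I != set0) && is_po_interval I) s,
      pairwise precedes s & is_po_interval (\bigcup_(I <- s) I)].

(* [adj2 I J IJ]: the pair (I, J) is adjacent, with union IJ. Naming the union
   avoids transporting along (I :|: J) :|: K = I :|: (J :|: K). *)
Definition adj2 (I J IJ : po_interval) : bool :=
  adjacent [:: po_set I; po_set J] && (po_set IJ == po_set I :|: po_set J).

Definition noncomparable (I J : {set P}) : bool :=
  [disjoint I & J] && [forall p in I, forall q in J, (p >< q)%O].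

(* Every adjacent triple yields the four adjacent pairs used in the braid
   diagram. *)
Lemma adjacent3_interval12 (I J K : po_interval) :
  adjacent [:: po_set I; po_set J; po_set K] -> is_po_interval (I :|: J).
Proof.
case/and3P => _ /= /andP[/and3P[_ ik _] /andP[/andP[jk _] _]] union.
pose U := PoInterval union.
apply/forallP => p; apply/implyP => pI; apply/forallP => q; apply/implyP => qI.
apply/forallP => r; apply/implyP => /[dup] prq /andP[_ rq].
have UE s : s \in po_set U =
    [|| s \in po_set I, s \in po_set J | s \in po_set K].
  by rewrite /= !big_cons big_nil setU0 !inE.
have inU s : s \in I :|: J -> s \in po_set U.
  by rewrite UE inE => /orP[] ->; rewrite ?orbT.
have := po_intervalP (inU _ pI) (inU _ qI) prq.
rewrite UE inE; case/or3P => [->//|->|rK]; first by rewrite orbT.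
move: qI; rewrite inE => /orP[qI|qJ].
  case/andP: ik => _ /forallP/(_ q)/implyP/(_ qI)/forallP/(_ r)/implyP/(_ rK).
  by rewrite rq.
case/andP: jk => _ /forallP/(_ q)/implyP/(_ qJ)/forallP/(_ r)/implyP/(_ rK).
by rewrite rq.
Qed.

Lemma adjacent3_interval23 (I J K : po_interval) :
  adjacent [:: po_set I; po_set J; po_set K] -> is_po_interval (J :|: K).
Proof.
case/and3P => _ /= /andP[/and3P[ij ik _] _] union.
pose U := PoInterval union.
apply/forallP => p; apply/implyP => pI; apply/forallP => q; apply/implyP => qI.
apply/forallP => r; apply/implyP => /[dup] prq /andP[pr _].
have UE s : s \in po_set U =
    [|| s \in po_set I, s \in po_set J | s \in po_set K].
  by rewrite /= !big_cons big_nil setU0 !inE.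
have inU s : s \in J :|: K -> s \in po_set U.
  by rewrite UE inE => /orP[] ->; rewrite ?orbT.
have := po_intervalP (inU _ pI) (inU _ qI) prq.
rewrite UE inE; case/or3P => [rI|->//|->]; last by rewrite orbT.
move: pI; rewrite inE => /orP[pJ|pK].
  case/andP: ij => _ /forallP/(_ r)/implyP/(_ rI)/forallP/(_ p)/implyP/(_ pJ).
  by rewrite pr.
case/andP: ik => _ /forallP/(_ r)/implyP/(_ rI)/forallP/(_ p)/implyP/(_ pK).
by rewrite pr.
Qed.

Lemma adjacent3_adj2 (I J K IJ JK IJK : po_interval) :
  adjacent [:: po_set I; po_set J; po_set K] ->
  po_set IJ = I :|: J -> po_set JK = J :|: K -> po_set IJK = I :|: J :|: K ->
  [&& adj2 I J IJ, adj2 J K JK, adj2 I JK IJK & adj2 IJ K IJK].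
Proof.
move=> IJKa IJE JKE IJKE.
have prec a b (A B : {set P}) :
    precedes A B -> a \in A -> b \in B -> ~~ (b < a)%O.
  case/andP=> _ /forallP/(_ a)/implyP h aA.
  by move/forallP/(_ b)/implyP: (h aA); apply.
case/and3P: IJKa => /and4P[/andP[I0 _] /andP[J0 _] /andP[K0 _] _].
case/andP => /and3P[ij ik _] /andP[/andP[jk _] _] _.
have djU (A B E : {set P}) :
    [disjoint A & B :|: E] = [disjoint A & B] && [disjoint A & E].
  by rewrite -!setI_eq0 setIUr setU_eq0.
have iJK : precedes I JK.
  apply/andP; split.
    by rewrite JKE djU; case/andP: ij => -> _; case/andP: ik.
  apply/forallP => p; apply/implyP => pI; apply/forallP => q; apply/implyP.
  by rewrite JKE inE => /orP[]; [exact: prec ij _ | exact: prec ik _].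
have ijK : precedes IJ K.
  apply/andP; split.
    rewrite IJE disjoint_sym djU ![[disjoint K & _]]disjoint_sym.
    by case/andP: ik => -> _; case/andP: jk.
  apply/forallP => p; apply/implyP; rewrite IJE inE => pIJ.
  apply/forallP => q; apply/implyP => qK.
  by case/orP: pIJ => ?; [exact: prec ik _ _ | exact: prec jk _ _].
have JK0 : po_set JK != set0 by rewrite JKE setU_eq0 (negPf J0).
have IJ0 : po_set IJ != set0 by rewrite IJE setU_eq0 (negPf I0).
have adjE (A B AB : po_interval) : po_set A != set0 -> po_set B != set0 ->
    precedes A B -> po_set AB = A :|: B -> adj2 A B AB.
  move=> A0 B0 AB0 ABE; rewrite /adj2 /adjacent /= A0 B0 AB0 ABE eqxx.
  rewrite !big_cons big_nil setU0 -ABE.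
  by rewrite (valP A) (valP B) (valP AB).
by rewrite !adjE // ?IJKE ?JKE ?IJE ?setUA.
Qed.

End Intervals.

(* Maps of degree -1 are indexed by a pair of degrees (k, l) with k = l + 1,
   which avoids casts between the degrees k and k - 1 + 1. *)
Record graded_module_braid (R : pzRingType) (d : Order.disp_t)
    (P : finPOrderType d) := GradedModuleBraid {
  gmod :> po_interval P -> int -> lmodType R;
  br_i : forall I J IJ : po_interval P, adj2 I J IJ ->
    forall k, {linear gmod I k -> gmod IJ k};
  br_p : forall I J IJ : po_interval P, adj2 I J IJ ->
    forall k, {linear gmod IJ k -> gmod J k};
  br_d : forall I J IJ : po_interval P, adj2 I J IJ ->
    forall k l : int, k = l + 1 -> {linear gmod J k -> gmod I l};
  br_exact_ip : forall I J IJ (a : adj2 I J IJ) k (y : gmod IJ k),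
    br_p a k y = 0 <-> exists x, br_i a k x = y;
  br_exact_pd : forall I J IJ (a : adj2 I J IJ) (k l : int) (e : k = l + 1)
      (y : gmod J k),
    br_d a e y = 0 <-> exists x, br_p a k x = y;
  br_exact_di : forall I J IJ (a : adj2 I J IJ) (k l : int) (e : k = l + 1)
      (y : gmod I l),
    br_i a l y = 0 <-> exists x, br_d a e x = y;
  br_noncomparable : forall I J IJ (a : adj2 I J IJ) (b : adj2 J I IJ),
    noncomparable I J -> forall k x, br_p b k (br_i a k x) = x;
  (* The triangles and squares of the braid diagram of (I, J, K). *)
  br_braid : forall I J K IJ JK IJK : po_interval P,
    adjacent [:: po_set I; po_set J; po_set K] ->
    forall (a : adj2 I J IJ) (b : adj2 J K JK)
           (u : adj2 I JK IJK) (v : adj2 IJ K IJK),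
    (forall k x, br_i v k (br_i a k x) = br_i u k x) /\
    (forall k x, br_p b k (br_p u k x) = br_p v k x) /\
    (forall k x, br_p u k (br_i v k x) = br_i b k (br_p a k x)) /\
    (forall (k l : int) (e : k = l + 1) x,
      br_d u e (br_i b k x) = br_d a e x) /\
    (forall (k l : int) (e : k = l + 1) x,
      br_p a l (br_d v e x) = br_d b e x) /\
    (forall (k l : int) (e : k = l + 1) x,
       br_d v e (br_p b k x) = br_i a l (br_d u e x))
}.

Record braid_map (R : pzRingType) (d : Order.disp_t) (P : finPOrderType d)
    (G G' : graded_module_braid R P) := BraidMap {
  braid_fun :> forall (I : po_interval P) k, {linear G I k -> G' I k};
  braid_fun_i : forall I J IJ (a : adj2 I J IJ) k x,
    braid_fun IJ k (br_i G a k x) = br_i G' a k (braid_fun I k x);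
  braid_fun_p : forall I J IJ (a : adj2 I J IJ) k x,
    braid_fun J k (br_p G a k x) = br_p G' a k (braid_fun IJ k x);
  braid_fun_d : forall I J IJ (a : adj2 I J IJ) (k l : int) (e : k = l + 1) x,
    braid_fun I l (br_d G a e x) = br_d G' a e (braid_fun J k x)
}.

Definition braid_iso (R : pzRingType) (d : Order.disp_t) (P : finPOrderType d)
    (G G' : graded_module_braid R P) (theta : braid_map G G') : Prop :=
  forall I k, bijective (theta I k).

Section DirectSum.
Variables (R : pzRingType) (T : finType).
Implicit Types (C : T -> int -> lmodType R) (I J K : {set T}) (k l : int).

Definition dsum C I (k : int) : lmodType R :=
  {dffun forall p : {p | p \in I}, C (val p) k}.

(* The p-th coordinate of x, read as 0 when p is not in I. *)
Definition coord C I k (x : dsum C I k) (p : T) : C p k :=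
  match @idP (p \in I) with
  | ReflectT pI => (x : {dffun forall p : {p | p \in I}, C (val p) k})
                     (exist _ p pI)
  | ReflectF _ => 0
  end.

Definition of_coord C I k (c : forall p, C p k) : dsum C I k :=
  [ffun p : {p | p \in I} => c (val p)] : {dffun forall p, C (val p) k}.

Lemma coordK C I k (x : dsum C I k) : of_coord I (coord x) = x.
Proof.
apply/ffunP => -[p pI]; rewrite ffunE /= /coord.
case: {-}_ / idP => // pI'.
by congr (fun_of_fin _ (exist _ p _)); apply: bool_irrelevance.
Qed.

Lemma coord_of C I k (c : forall p, C p k) p :
  coord (of_coord I c) p = if p \in I then c p else 0.
Proof.
rewrite /coord; case: {-}_ / idP => [pI|]; last by move/negP/negPf => ->.
by rewrite ffunE /= pI.
Qed.

Lemma coord_out C I k (x : dsum C I k) p : p \notin I -> coord x p = 0.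
Proof. by rewrite -(coordK x) coord_of => /negPf ->. Qed.

Lemma coordP C I k (x y : dsum C I k) :
  (forall p, p \in I -> coord x p = coord y p) -> x = y.
Proof.
move=> xy; rewrite -(coordK x) -(coordK y).
by apply/ffunP => -[p pI]; rewrite !ffunE /= xy.
Qed.

Fact coord_is_linear C I k p : linear ((@coord C I k)^~ p).
Proof.
move=> a x y /=; rewrite /coord; case: {-}_ / idP => pI.
  by rewrite !ffunE.
by rewrite scaler0 addr0.
Qed.

Lemma coordD C I k (x y : dsum C I k) p :
  coord (x + y) p = coord x p + coord y p.
Proof. by have := coord_is_linear p 1 x y; rewrite !scale1r. Qed.

Lemma coord0 C I k p : coord (0 : dsum C I k) p = 0.
Proof.
by apply: (addrI (coord (0 : dsum C I k) p)); rewrite -coordD !addr0.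
Qed.

Lemma coordB C I k (x y : dsum C I k) p :
  coord (x - y) p = coord x p - coord y p.
Proof. by apply/eqP; rewrite eq_sym subr_eq -coordD subrK. Qed.

Lemma coord_sum C I k (r : seq T) (F : T -> dsum C I k) p :
  coord (\sum_(q <- r) F q) p = \sum_(q <- r) coord (F q) p.
Proof.
apply: (big_morph (fun x : dsum C I k => coord x p)) => [x y|].
  exact: coordD.
exact: coord0.
Qed.

Definition res_fun C I J k (x : dsum C I k) : dsum C J k :=
  of_coord J (coord x).

Fact res_is_linear C I J k : linear (@res_fun C I J k).
Proof.
move=> a x y; apply: coordP => p pJ; rewrite coord_is_linear !coord_of pJ.
by rewrite coord_is_linear.
Qed.
HB.instance Definition _ C I J k := GRing.isLinear.Build R (dsum C I k)
  (dsum C J k) *:%R (@res_fun C I J k) (@res_is_linear C I J k).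

(* Restriction of the index set from I to I :&: J followed by extension by 0
   to J: the inclusion if I \subset J, the projection if J \subset I. *)
Definition res C I J k : {linear dsum C I k -> dsum C J k} := @res_fun C I J k.

Definition single C q k (c : C q k) : dsum C [set: T] k :=
  of_coord [set: T] (fun p => match q =P p with
    | ReflectT e => eq_rect q (fun p => C p k) c p e
    | ReflectF _ => 0
    end).

Definition entry C C' k l (f : {linear dsum C [set: T] k -> dsum C' [set: T] l})
    (p q : T) (c : C q k) : C' p l := coord (f (single c)) p.

(* The submatrix with rows in I and columns in J. *)
Definition block C C' k l (f : {linear dsum C [set: T] k -> dsum C' [set: T] l})
    I J : {linear dsum C J k -> dsum C' I l} :=
  res C' [set: T] I l \o f \o res C J [set: T] k.

Lemma coord_res C I J k (x : dsum C I k) p :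
  coord (res C I J k x) p = if p \in J then coord x p else 0.
Proof. exact: coord_of. Qed.

Lemma res_res C I J K k (x : dsum C I k) :
  I :&: K \subset J -> res C J K k (res C I J k x) = res C I K k x.
Proof.
move=> /subsetP IKJ; apply: coordP => p pK; rewrite !coord_res pK.
case: ifPn => // pJ; rewrite coord_out //.
by apply: contra pJ => pI; rewrite IKJ // inE pI.
Qed.

Lemma res_id C I k (x : dsum C I k) : res C I I k x = x.
Proof. by apply: coordP => p pK; rewrite coord_res pK. Qed.

Lemma res_disj C I J k (x : dsum C I k) : [disjoint I & J] -> res C I J k x = 0.
Proof.
move=> IJ; apply: coordP => p pJ; rewrite coord_res pJ coord0 coord_out //.
by rewrite (disjointFl IJ pJ).
Qed.

Lemma res_split C I J K k (x : dsum C K k) : K = I :|: J -> [disjoint I & J] ->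
  x = res C I K k (res C K I k x) + res C J K k (res C K J k x).
Proof.
move=> KE IJ; apply: coordP => p pK; rewrite coordD !coord_res pK.
have {pK} : (p \in I) || (p \in J) by rewrite -in_setU -KE.
case: ifPn => [pI _|_ /= pJ].
  by rewrite (disjointFr IJ pI) addr0.
by rewrite pJ add0r.
Qed.

Lemma single_sum C k (x : dsum C [set: T] k) :
  x = \sum_(q <- enum T) single (coord x q).
Proof.
apply: coordP => p _; rewrite coord_sum (bigD1_seq p) ?mem_enum ?enum_uniq //=.
rewrite big1 ?addr0 => [|q qp]; rewrite coord_of in_setT; last first.
  by case: eqP => // e; rewrite e eqxx in qp.
by case: eqP => // e; rewrite (eq_irrelevance e erefl).
Qed.

End DirectSum.

Section Triangular.
Variables (R : pzRingType) (d : Order.disp_t) (P : finPOrderType d).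
Implicit Types (C : P -> int -> lmodType R) (k l m : int).

Definition upper_triangular C C' k l
    (f : {linear dsum C [set: P] k -> dsum C' [set: P] l}) : Prop :=
  forall p q (c : C q k), entry f p c != 0 -> (p <= q)%O.

Lemma upper_triangular_coord C C' k l
    (f : {linear dsum C [set: P] k -> dsum C' [set: P] l}) x p :
  upper_triangular f -> (forall q, (p <= q)%O -> coord x q = 0) ->
  coord (f x) p = 0.
Proof.
move=> fut x0; rewrite (single_sum x) linear_sum coord_sum big1 // => q _.
have [pq|pq] := boolP (p <= q)%O; last first.
  by apply/eqP; apply: contraR pq => /fut.
rewrite x0 //; suff -> : single (0 : C q k) = 0 by rewrite linear0 coord0.
apply: coordP => r _; rewrite coord_of in_setT coord0.
by case: eqP => // e; case: _ / e.
Qed.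

Record boundary_map C := BoundaryMap {
  bmap : forall k l : int, k = l + 1 ->
    {linear dsum C [set: P] k -> dsum C [set: P] l};
  bmap_triangular : forall k l (e : k = l + 1), upper_triangular (bmap e);
  bmap_square : forall k l m (e : k = l + 1) (e' : l = m + 1) x,
    bmap e' (bmap e x) = 0
}.
End Triangular.

Section ChainComplexBraid.
Variables (R : pzRingType) (d : Order.disp_t) (P : finPOrderType d).
Variables (C : P -> int -> lmodType R) (D : boundary_map C).
Implicit Types (A B I J K : {set P}) (k l m n : int).

Local Notation res := (res C).
Local Notation blk e I J := (block (bmap D e) I J).

(* The differential of the complex C(I). *)
Definition cdiff I k l (e : k = l + 1) : {linear dsum C I k -> dsum C I l} :=
  blk e I I.

Definition chomology I (k : int) : lmodType R :=
  homology (cdiff I (erefl (k + 1))) (cdiff I (esym (subrK 1 k))).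

Definition cclass I k := hclass (cdiff I (erefl (k + 1)))
  (cdiff I (esym (subrK 1 k))).

Lemma blkE k l (e : k = l + 1) I J x :
  blk e I J x = res _ I l (bmap D e (res J _ k x)).
Proof. by []. Qed.

Lemma blk0_irr k l l' (e : k = l + 1) (e' : k = l' + 1) I J x :
  blk e I J x = 0 -> blk e' I J x = 0.
Proof.
have ll' : l = l' by apply: (addIr 1); rewrite -e.
by move: e'; rewrite -ll' => e'; rewrite (eq_irrelevance e' e).
Qed.

Lemma blk_split k l (e : k = l + 1) A I J K (x : dsum C K k) :
  K = I :|: J -> [disjoint I & J] ->
  blk e A K x = blk e A I (res K I k x) + blk e A J (res K J k x).
Proof.
move=> KE IJ; rewrite !blkE -!linearD; congr (res _ _ _ (bmap D e _)).
rewrite {1}(res_split x KE IJ) linearD /=.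
by congr (_ + _); rewrite res_res // setIT KE ?subsetUl ?subsetUr.
Qed.

Lemma res_blk k l (e : k = l + 1) A B K x :
  A \subset K -> res K A l (blk e K B x) = blk e A B x.
Proof. by move=> AK; rewrite !blkE res_res // setTI. Qed.

Lemma blk_res k l (e : k = l + 1) A B K x :
  B \subset K -> blk e A K (res B K k x) = blk e A B x.
Proof. by move=> AK; rewrite !blkE res_res // setIT. Qed.

Lemma blk_zero k l (e : k = l + 1) A B x :
  (forall p q, p \in A -> q \in B -> ~~ (p <= q)%O) -> blk e A B x = 0.
Proof.
move=> AB; apply: coordP => p pA; rewrite blkE coord_res pA coord0.
apply: upper_triangular_coord; first exact: bmap_triangular.
move=> q pq; rewrite coord_res in_setT coord_out //.
by apply/negP => qB; have := AB _ _ pA qB; rewrite pq.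
Qed.

Lemma cdiff_sq (I : po_interval P) k l m (e : k = l + 1) (e' : l = m + 1) x :
  cdiff I e' (cdiff I e x) = 0.
Proof.
apply: coordP => p pI; rewrite /cdiff blkE coord_res pI coord0.
set y := bmap D e (res I _ k x).
rewrite -[coord _ p]subr0 -[X in _ - X](coord0 C setT m p).
rewrite -(bmap_square D e e' (res I _ k x)) -coordB -linearB /=.
apply: upper_triangular_coord; first exact: bmap_triangular.
move=> q pq; rewrite coordB coord_res in_setT [coord (res_fun _ _) _]coord_of -/y.
case: ifPn => [_|qI]; first by rewrite subrr.
rewrite sub0r upper_triangular_coord ?oppr0 //; first exact: bmap_triangular.
move=> r qr; rewrite coord_of in_setT coord_out //.
apply: contra qI => rI.
move: pq qr; rewrite !le_eqVlt.
case: eqP => [<- //|_ /= pq]; case: eqP => [-> //|_ /= qr].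
by apply: (po_intervalP pI rI); rewrite pq.
Qed.

Section AdjacentPair.
Variables (I J K : po_interval P) (a : adj2 I J K).

Lemma adj2_union : po_set K = po_set I :|: po_set J.
Proof. by case/andP: a => _ /eqP. Qed.

Lemma adj2_disjoint : [disjoint I & J].
Proof. by case/andP: a => /and3P[_ /= /andP[/andP[/andP[]]]]. Qed.

Lemma adj2_sub1 : I \subset K. Proof. by rewrite adj2_union subsetUl. Qed.
Lemma adj2_sub2 : J \subset K. Proof. by rewrite adj2_union subsetUr. Qed.

Lemma adj2_nle p q : p \in po_set J -> q \in po_set I -> ~~ (p <= q)%O.
Proof.
move=> pJ qI; rewrite le_eqVlt negb_or; apply/andP; split.
  by apply: contraTneq pJ => ->; rewrite (disjointFr adj2_disjoint qI).
case/andP: a => /and3P[_ /= /andP[/andP[/andP[_ ij] _] _] _] _.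
by move/forallP/(_ q)/implyP/(_ qI)/forallP/(_ p)/implyP/(_ pJ): ij.
Qed.

Lemma res_blkK k l (e : k = l + 1) (x : dsum C K k) :
  res K I l (cdiff K e x) = cdiff I e (res K I k x) + blk e I J (res K J k x).
Proof.
by rewrite res_blk ?adj2_sub1 // (blk_split e _ x adj2_union adj2_disjoint).
Qed.

Lemma res_cdiff2 k l (e : k = l + 1) (x : dsum C K k) :
  res K J l (cdiff K e x) = cdiff J e (res K J k x).
Proof.
rewrite res_blk ?adj2_sub2 // (blk_split e _ x adj2_union adj2_disjoint).
by rewrite blk_zero ?add0r //; exact: adj2_nle.
Qed.

Lemma adj2_ext k (x y : dsum C K k) : res K I k x = res K I k y ->
  res K J k x = res K J k y -> x = y.
Proof.
move=> xI xJ; rewrite (res_split x adj2_union adj2_disjoint) xI xJ.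
by rewrite -(res_split y adj2_union adj2_disjoint).
Qed.

Lemma res11 k x : res K I k (res I K k x) = x.
Proof. by rewrite res_res ?res_id // setIid adj2_sub1. Qed.
Lemma res22 k x : res K J k (res J K k x) = x.
Proof. by rewrite res_res ?res_id // setIid adj2_sub2. Qed.
Lemma res12 k x : res K J k (res I K k x) = 0.
Proof.
by rewrite res_res ?res_disj ?adj2_disjoint // (subset_trans _ adj2_sub1) ?subsetIl.
Qed.
Lemma res21 k x : res K I k (res J K k x) = 0.
Proof.
rewrite res_res ?res_disj 1?disjoint_sym ?adj2_disjoint //.
by rewrite (subset_trans _ adj2_sub2) ?subsetIl.
Qed.

Lemma res_cdiff1 k l (e : k = l + 1) (x : dsum C I k) :
  cdiff K e (res I K k x) = res I K l (cdiff I e x).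
Proof.
apply: adj2_ext; first by rewrite res_blkK res11 res12 linear0 addr0 res11.
by rewrite res_cdiff2 !res12 linear0.
Qed.

Lemma blk_anti k l m (e : k = l + 1) (e' : l = m + 1) (z : dsum C J k) :
  cdiff I e' (blk e I J z) = - blk e' I J (cdiff J e z).
Proof.
have := congr1 (res K I m) (@cdiff_sq K _ _ _ e e' (res J K k z)).
rewrite linear0 res_blkK res_blkK res_cdiff2 res21 res22 linear0 add0r.
by move/eqP; rewrite addr_eq0 => /eqP.
Qed.

Fact ci_cycle k l (e : k = l + 1) x :
  cdiff I e x = 0 -> cdiff K e (res I K k x) = 0.
Proof. by move=> x0; rewrite res_cdiff1 x0 linear0. Qed.

Fact ci_boundary k l (e : k = l + 1) u :
  exists u', cdiff K e u' = res I K l (cdiff I e u).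
Proof. by exists (res I K _ u); rewrite res_cdiff1. Qed.

Definition ci k : {linear chomology I k -> chomology K k} :=
  homology_map (@ci_cycle _ _ _) (@ci_boundary _ _ _).

Fact cp_cycle k l (e : k = l + 1) x :
  cdiff K e x = 0 -> cdiff J e (res K J k x) = 0.
Proof. by move=> x0; rewrite -res_cdiff2 x0 linear0. Qed.

Fact cp_boundary k l (e : k = l + 1) u :
  exists u', cdiff J e u' = res K J l (cdiff K e u).
Proof. by exists (res K J _ u); rewrite -res_cdiff2. Qed.

Definition cp k : {linear chomology K k -> chomology J k} :=
  homology_map (@cp_cycle _ _ _) (@cp_boundary _ _ _).

Fact cd_cycle k l m n (e : k = l + 1) (e' : l = m + 1) (e'' : k = n + 1) x :
  cdiff J e'' x = 0 -> cdiff I e' (blk e I J x) = 0.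
Proof. by move=> x0; rewrite blk_anti (blk0_irr e x0) linear0 oppr0. Qed.

Fact cd_boundary k l (e : k = l + 1) u :
  exists u', cdiff I (erefl (l + 1)) u' =
             blk e I J (cdiff J (erefl (k + 1)) u).
Proof.
subst k; exists (- blk (erefl (l + 1 + 1)) I J u).
by rewrite linearN blk_anti opprK.
Qed.

(* Lifting a cycle z of C(J) to C(IJ) by zero and applying the differential of
   C(IJ) gives the element blk e I J z of C(I). *)
Definition cd k l (e : k = l + 1) : {linear chomology J k -> chomology I l} :=
  homology_map (@cd_cycle _ _ _ _ e _ _) (@cd_boundary _ _ e).

End AdjacentPair.

Local Notation cyc I k := (cycle (cdiff I (esym (subrK 1 k)))).

Lemma cycE k l (e : k = l + 1) I (z : cyc I k) : cdiff I e (cycle_val z) = 0.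
Proof. exact: (blk0_irr e (cycleP z)). Qed.

Lemma cycP k l (e : k = l + 1) I (x : dsum C I k) :
  cdiff I e x = 0 -> exists z : cyc I k, cycle_val z = x.
Proof. by move=> x0; exists (mk_cycle (blk0_irr (esym (subrK 1 k)) x0)). Qed.

Lemma cclass_eq0 k l (e : k = l + 1) I (z : cyc I l) :
  cclass I l z = 0 <-> exists u, cdiff I e u = cycle_val z.
Proof. by subst k; exact: hclass_eq0. Qed.

Lemma cclass_eq k l (e : k = l + 1) I (z t : cyc I l) :
  (exists u, cdiff I e u = cycle_val z - cycle_val t) ->
  cclass I l z = cclass I l t.
Proof.
move=> h; apply/eqP; rewrite -subr_eq0 -linearB; apply/eqP.
by apply/(cclass_eq0 e).
Qed.

Lemma cclass_surj I k (h : chomology I k) : exists z, cclass I k z = h.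
Proof. exact: hclass_surj. Qed.

Section Maps.
Variables (I J K : po_interval P) (a : adj2 I J K).

Lemma ci_class k z t : cycle_val t = res I K k (cycle_val z) ->
  ci a k (cclass I k z) = cclass K k t.
Proof.
move=> tE; rewrite [LHS]homology_mapE.
by apply: (congr1 (cclass K k)); exact: val_inj.
Qed.

Lemma cp_class k z t : cycle_val t = res K J k (cycle_val z) ->
  cp a k (cclass K k z) = cclass J k t.
Proof.
move=> tE; rewrite [LHS]homology_mapE.
by apply: (congr1 (cclass J k)); exact: val_inj.
Qed.

Lemma cd_class k l (e : k = l + 1) z t : cycle_val t = blk e I J (cycle_val z) ->
  cd a e (cclass J k z) = cclass I l t.
Proof.
move=> tE; rewrite [LHS]homology_mapE.
by apply: (congr1 (cclass I l)); exact: val_inj.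
Qed.

Lemma ci_cyc k (z : cyc I k) : exists t : cyc K k, cycle_val t = res I K k (cycle_val z).
Proof. exact: cycP (ci_cycle a (cycleP z)). Qed.

Lemma cp_cyc k (z : cyc K k) : exists t : cyc J k, cycle_val t = res K J k (cycle_val z).
Proof. exact: cycP (cp_cycle a (cycleP z)). Qed.

Lemma cd_cyc k l (e : k = l + 1) (z : cyc J k) :
  exists t : cyc I l, cycle_val t = blk e I J (cycle_val z).
Proof. exact: cycP (cd_cycle a e (esym (subrK 1 l)) (cycleP z)). Qed.

Lemma cexact_ip k (y : chomology K k) :
  cp a k y = 0 <-> exists x, ci a k x = y.
Proof.
split=> [|[x <-]]; last first.
  have [z <-] := cclass_surj x; have [t tE] := ci_cyc z.
  have [s sE] := cp_cyc t.
  rewrite (ci_class tE) (cp_class sE); apply/(cclass_eq0 (erefl _)).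
  by exists 0; rewrite linear0 sE tE (res12 a).
have [z <-] := cclass_surj y; have [t tE] := cp_cyc z.
rewrite (cp_class tE) => /(cclass_eq0 (erefl _))[u uE].
pose w := cycle_val z - cdiff K (erefl _) (res J K _ u).
have wJ : res K J k w = 0.
  by rewrite linearB (res_cdiff2 a) (res22 a) uE tE subrr.
have wK : cdiff K (esym (subrK 1 k)) w = 0.
  by rewrite linearB cycleP (@cdiff_sq K) subrr.
have wE : res I K k (res K I k w) = w.
  by apply: (adj2_ext a); rewrite ?(res11 a) ?(res12 a) ?wJ.
have [v vE] : exists v : cyc I k, cycle_val v = res K I k w.
  apply: (cycP (e := esym (subrK 1 k))).
  have := congr1 (res K I _) wK; rewrite linear0 => <-.
  by rewrite (res_blkK a) wJ linear0 addr0.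
have [s sE] := ci_cyc v.
exists (cclass I k v); rewrite (ci_class sE).
apply/(cclass_eq (e := erefl _)); exists (- res J K _ u).
by rewrite linearN sE vE wE /w addrAC subrr add0r.
Qed.

Lemma cexact_pd k l (e : k = l + 1) (y : chomology J k) :
  cd a e y = 0 <-> exists x, cp a k x = y.
Proof.
subst k; split=> [|[x <-]]; last first.
  have [z <-] := cclass_surj x; have [t tE] := cp_cyc z.
  have [s sE] := cd_cyc (erefl _) t.
  rewrite (cp_class tE) (cd_class sE); apply/(cclass_eq0 (erefl _)).
  exists (- res K I _ (cycle_val z)); rewrite linearN sE tE.
  have := congr1 (res K I _) (cycE (erefl _) z).
  rewrite (res_blkK a) linear0 => /eqP.
  by rewrite addr_eq0 => /eqP ->; rewrite opprK.
have [z <-] := cclass_surj y; have [t tE] := cd_cyc (erefl _) z.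
rewrite (cd_class tE) => /(cclass_eq0 (erefl _))[u uE].
pose w0 := res J K _ (cycle_val z) - res I K _ u.
have w0I : res K I _ w0 = - u by rewrite linearB (res21 a) (res11 a) sub0r.
have w0J : res K J _ w0 = cycle_val z.
  by rewrite linearB (res22 a) (res12 a) subr0.
have [w wE] : exists w : cyc K (l + 1), cycle_val w = w0.
  apply: (cycP (e := erefl _)); apply: (adj2_ext a).
    by rewrite (res_blkK a) w0I w0J linearN uE tE addNr linear0.
  by rewrite (res_cdiff2 a) w0J cycE linear0.
exists (cclass K _ w).
have [s sE] := cp_cyc w; rewrite (cp_class sE).
apply/(cclass_eq (e := erefl _)); exists 0; rewrite linear0 sE wE w0J.
by rewrite subrr.
Qed.

Lemma cexact_di k l (e : k = l + 1) (y : chomology I l) :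
  ci a l y = 0 <-> exists x, cd a e x = y.
Proof.
subst k; split=> [|[x <-]]; last first.
  have [z <-] := cclass_surj x; have [t tE] := cd_cyc (erefl _) z.
  have [s sE] := ci_cyc t.
  rewrite (cd_class tE) (ci_class sE); apply/(cclass_eq0 (erefl _)).
  exists (res J K _ (cycle_val z)); rewrite sE tE; apply: (adj2_ext a).
    by rewrite (res_blkK a) (res21 a) (res22 a) linear0 add0r (res11 a).
  by rewrite (res_cdiff2 a) (res22 a) (res12 a) cycE.
have [z <-] := cclass_surj y; have [t tE] := ci_cyc z.
rewrite (ci_class tE) => /(cclass_eq0 (erefl _))[u uE].
have [w wE] : exists w : cyc J (l + 1), cycle_val w = res K J _ u.
  apply: (cycP (e := erefl _)).
  by rewrite -(res_cdiff2 a) uE tE (res12 a).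
exists (cclass J _ w).
have [s sE] := cd_cyc (erefl _) w; rewrite (cd_class sE).
apply/(cclass_eq (e := erefl _)); exists (- res K I _ u).
rewrite linearN sE wE.
have := congr1 (res K I _) uE; rewrite tE (res11 a) (res_blkK a) => <-.
by rewrite opprD addrCA subrr addr0.
Qed.

End Maps.

Lemma cnoncomparable (I J K : po_interval P) (a : adj2 I J K) (b : adj2 J I K)
  k x : cp b k (ci a k x) = x.
Proof.
have [z <-] := cclass_surj x; have [t tE] := ci_cyc a z.
by rewrite (ci_class a tE); apply: cp_class; rewrite tE (res11 a).
Qed.

Section Triple.
Variables (I J K IJ JK IJK : po_interval P).
Variables (a : adj2 I J IJ) (b : adj2 J K JK).
Variables (u : adj2 I JK IJK) (v : adj2 IJ K IJK).

Lemma adj3_meet : po_set IJ :&: po_set JK = po_set J.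
Proof.
apply/setP => p; rewrite (adj2_union a) (adj2_union b) !inE.
have := disjointFr (adj2_disjoint u) (x := p).
rewrite (adj2_union b) inE; case: (p \in po_set I) => [/(_ isT)|_] /=.
  by case: (p \in po_set J).
by case: (p \in po_set J).
Qed.

Lemma cbraid1 k x : ci v k (ci a k x) = ci u k x.
Proof.
have [z <-] := cclass_surj x; have [t tE] := ci_cyc a z.
have [s sE] := ci_cyc v t; rewrite (ci_class a tE) (ci_class v sE).
apply/esym/ci_class; rewrite sE tE res_res //.
by rewrite (subset_trans _ (adj2_sub1 a)) ?subsetIl.
Qed.

Lemma cbraid2 k x : cp b k (cp u k x) = cp v k x.
Proof.
have [z <-] := cclass_surj x; have [t tE] := cp_cyc u z.
have [s sE] := cp_cyc b t; rewrite (cp_class u tE) (cp_class b sE).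
apply/esym/cp_class; rewrite sE tE res_res //.
by rewrite (subset_trans _ (adj2_sub2 b)) ?subsetIr.
Qed.

Lemma cbraid3 k x : cp u k (ci v k x) = ci b k (cp a k x).
Proof.
have [z <-] := cclass_surj x; have [t tE] := ci_cyc v z.
have [s sE] := cp_cyc u t; rewrite (ci_class v tE) (cp_class u sE).
have [t' t'E] := cp_cyc a z; have [s' s'E] := ci_cyc b t'.
rewrite (cp_class a t'E); apply/esym/ci_class; rewrite sE tE t'E !res_res //.
  by rewrite adj3_meet.
by rewrite (subset_trans _ (adj2_sub1 v)) ?subsetIl.
Qed.

Lemma cbraid4 k l (e : k = l + 1) x : cd u e (ci b k x) = cd a e x.
Proof.
have [z <-] := cclass_surj x; have [t tE] := ci_cyc b z.
have [s sE] := cd_cyc u e t; rewrite (ci_class b tE) (cd_class u sE).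
by apply/esym/cd_class; rewrite sE tE blk_res ?(adj2_sub1 b).
Qed.

Lemma cbraid5 k l (e : k = l + 1) x : cp a l (cd v e x) = cd b e x.
Proof.
have [z <-] := cclass_surj x; have [t tE] := cd_cyc v e z.
have [s sE] := cp_cyc a t; rewrite (cd_class v tE) (cp_class a sE).
by apply/esym/cd_class; rewrite sE tE res_blk ?(adj2_sub2 a).
Qed.

Lemma cbraid6 k l (e : k = l + 1) x :
  cd v e (cp b k x) = ci a l (cd u e x).
Proof.
have [z <-] := cclass_surj x; have [t tE] := cp_cyc b z.
have [s sE] := cd_cyc v e t; rewrite (cp_class b tE) (cd_class v sE).
have [t' t'E] := cd_cyc u e z; have [s' s'E] := ci_cyc a t'.
rewrite (cd_class u t'E) (ci_class a s'E).
apply: (cclass_eq (e := e)).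
exists (- res J IJ _ (res JK J _ (cycle_val z))).
rewrite linearN sE s'E tE t'E; apply: (adj2_ext a).
  rewrite linearN (res_blkK a) (res21 a) (res22 a) linear0 add0r.
  rewrite linearB (res11 a) res_blk ?(adj2_sub1 a) //.
  rewrite (blk_split e _ (cycle_val z) (adj2_union b) (adj2_disjoint b)).
  by rewrite opprD addrCA subrr addr0.
rewrite linearN (res_cdiff2 a) (res22 a) linearB (res12 a) subr0.
rewrite res_blk ?(adj2_sub2 a) //.
have := congr1 (res JK J _) (cycE e z).
rewrite (res_blkK b) linear0 => /eqP.
by rewrite addr_eq0 => /eqP ->; rewrite opprK.
Qed.
End Triple.

Definition chain_homology_braid : graded_module_braid R P :=
  @GradedModuleBraid R d P (fun I : po_interval P => chomology I)
    (@ci) (@cp) (@cd) (@cexact_ip) (@cexact_pd) (@cexact_di)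
    (fun (I J IJ : po_interval P) a b _ => cnoncomparable a b)
    (fun (I J K IJ JK IJK : po_interval P) _ a b u v =>
       conj (cbraid1 a u v) (conj (cbraid2 b u v) (conj (cbraid3 a b u v)
      (conj (cbraid4 a b u) (conj (cbraid5 a b v) (cbraid6 a b u v)))))).

End ChainComplexBraid.

Section ConnectionMatrix.
Variables (R : pzRingType) (d : Order.disp_t) (P : finPOrderType d).
Implicit Types (C : P -> int -> lmodType R) (G : graded_module_braid R P).
Implicit Types (k l : int).

Definition connection_matrix C (D : boundary_map C) G : Prop :=
  (exists Phi : braid_map (chain_homology_braid D) G, braid_iso Phi) /\
  (forall p : P, exists f : forall k, {linear C p k -> G (po_single p) k},
     forall k, bijective (f k)).

Definition trivial_boundary C (D : boundary_map C) : Prop :=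
  forall k l (e : k = l + 1) x, bmap D e x = 0.

Section ChainMap.
Variables (C C' : P -> int -> lmodType R).
Variables (D : boundary_map C) (D' : boundary_map C') (I : {set P}).
Variable h : forall k, {linear dsum C I k -> dsum C' I k}.

Definition chain_map : Prop := forall k l (e : k = l + 1) x,
  h l (cdiff D I e x) = cdiff D' I e (h k x).

Hypothesis hP : chain_map.

Fact chain_map_cycle k l (e : k = l + 1) x :
  cdiff D I e x = 0 -> cdiff D' I e (h k x) = 0.
Proof. by move=> x0; rewrite -hP x0 linear0. Qed.

Fact chain_map_boundary k l (e : k = l + 1) u :
  exists u', cdiff D' I e u' = h l (cdiff D I e u).
Proof. by exists (h k u); rewrite hP. Qed.

Definition chain_map_homology k :
    {linear chomology D I k -> chomology D' I k} :=
  homology_map (@chain_map_cycle _ _ _) (@chain_map_boundary _ _ _).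
End ChainMap.

Record transition_matrix C C' (D : boundary_map C) (D' : boundary_map C') G G'
    (T : forall k, {linear dsum C [set: P] k -> dsum C' [set: P] k}) : Prop :=
  TransitionMatrix {
  tm_chain : forall I : po_interval P,
    chain_map D D' (fun k => block (T k) I I);
  tm_i : forall I J IJ : po_interval P, adj2 I J IJ -> forall k x,
    block (T k) IJ IJ (res C I IJ k x) = res C' I IJ k (block (T k) I I x);
  tm_p : forall I J IJ : po_interval P, adj2 I J IJ -> forall k x,
    block (T k) J J (res C IJ J k x) = res C' IJ J k (block (T k) IJ IJ x);
  tm_covers : exists (theta : braid_map G G')
      (Phi : braid_map (chain_homology_braid D) G)
      (Phi' : braid_map (chain_homology_braid D') G'),
    [/\ braid_iso theta, braid_iso Phi, braid_iso Phi' &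
      forall (I : po_interval P) k x,
        Phi' I k (chain_map_homology (@tm_chain I) k x) = theta I k (Phi I k x)]
}.

Section Trivial.
Variables (C : P -> int -> lmodType R) (D : boundary_map C).
Hypothesis D0 : trivial_boundary D.
Variable I : {set P}.

Fact trivial_cdiff k l (e : k = l + 1) x : cdiff D I e x = 0.
Proof. by rewrite /cdiff blkE D0 linear0. Qed.

Definition trivial_cycle k (x : dsum C I k) :
    cycle (cdiff D I (esym (subrK 1 k))) :=
  mk_cycle (trivial_cdiff _ x).

Fact trivial_cycle_is_linear k : linear (@trivial_cycle k).
Proof. by move=> a x y; exact: val_inj. Qed.
HB.instance Definition _ k := GRing.isLinear.Build R _ _ *:%R
  (@trivial_cycle k) (@trivial_cycle_is_linear k).

(* The differential of C(I) being 0, this identifies C(I) with its homology. *)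
Definition trivial_class k : {linear dsum C I k -> chomology D I k} :=
  cclass D I k \o @trivial_cycle k.

Lemma trivial_class_bij k : bijective (trivial_class k).
Proof.
have inj : injective (trivial_class k).
  move=> x y /eqP; rewrite -subr_eq0 -linearB => /eqP.
  move/(cclass_eq0 (erefl (k + 1)))=> [u].
  by rewrite trivial_cdiff => /esym/= /subr0_eq.
have surj y : exists x, trivial_class k x == y.
  have [z <-] := cclass_surj y; exists (cycle_val z); apply/eqP.
  by apply: (congr1 (cclass D I k)); exact: val_inj.
exists (fun y => xchoose (surj y)) => x.
  by apply: inj; apply/eqP; exact: (xchooseP (surj _)).
by apply/eqP; exact: (xchooseP (surj _)).
Qed.
End Trivial.
End ConnectionMatrix.

(* Main.v *)
Require Import Defs.
From mathcomp Require Import all_boot all_order all_algebra.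

Set Implicit Arguments.
Unset Strict Implicit.
Unset Printing Implicit Defensive.

(** Since the boundaries vanish, [Phi'^-1 \o Theta \o Phi] is a family of maps
    [S I : C(I) -> C'(I)] which commutes with the inclusions and projections of
    adjacent pairs, and [T] is its member [S P].  Every interval [I] is a lower
    part of its upper closure [U], and [U] is an upper part of [P]; so the
    projection of [P] onto [U] and the inclusion of [I] in [U] identify [S I]
    with the diagonal block of [T] at [I].  Hence [T] covers [Theta]. *)

Import Order.TTheory GRing.Theory.
Local Open Scope ring_scope.

Section UpperClosure.
Context {d : Order.disp_t} {P : finPOrderType d}.
Implicit Types I J K : po_interval P.

Definition upper_closure (A : {set P}) : {set P} :=
  [set r | [exists q in A, (q <= r)%O]].

Lemma mem_upper_closure (A : {set P}) q r :
  q \in A -> (q <= r)%O -> r \in upper_closure A.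
Proof. by move=> qA qr; rewrite inE; apply/exists_inP; exists q. Qed.

Lemma upper_closure_up (A : {set P}) r s :
  r \in upper_closure A -> (r <= s)%O -> s \in upper_closure A.
Proof.
rewrite inE => /exists_inP[q qA qr] rs.
exact: mem_upper_closure qA (le_trans qr rs).
Qed.

Lemma sub_upper_closure (A : {set P}) : A \subset upper_closure A.
Proof. by apply/subsetP => q qA; exact: mem_upper_closure qA (lexx q). Qed.

Lemma is_po_intervalP (A : {set P}) :
  (forall p q r, p \in A -> q \in A -> (p < r)%O -> (r < q)%O -> r \in A) ->
  is_po_interval A.
Proof.
move=> h; apply/forall_inP => p pA; apply/forall_inP => q qA.
by apply/forallP => r; apply/implyP => /andP[]; exact: h.
Qed.

Lemma upper_closure_interval (A : {set P}) : is_po_interval (upper_closure A).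
Proof. by apply/is_po_intervalP => p q r pA _ /ltW /(upper_closure_up pA). Qed.

Lemma upper_closure_setC_interval (A : {set P}) :
  is_po_interval (~: upper_closure A).
Proof.
apply/is_po_intervalP => p q r _; rewrite !in_setC => qA _ /ltW rq.
by apply: contra qA => /upper_closure_up; exact.
Qed.

(** Such a [p] lies strictly above some [s] in [I], so [p < q] would put it in [I] by convexity.
    This makes [I] a lower part of its upper closure. *)
Lemma upper_closure_not_below I p q :
  p \in upper_closure I -> p \notin po_set I -> q \in po_set I -> ~~ (p < q)%O.
Proof.
rewrite inE => /exists_inP[s sI]; rewrite le_eqVlt => /predU1P[<-|sp] pI qI.
  by rewrite sI in pI.
by apply: contra pI => pq; apply: (po_intervalP sI qI); rewrite sp.
Qed.

(** The lower endpoint alone decides: what lies above [p] stays in the upper closure and cannot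
    re-enter [I]. *)
Lemma upper_closure_setD_interval I : is_po_interval (upper_closure I :\: I).
Proof.
apply/is_po_intervalP => p q r /setDP[pU pI] _ pr _.
rewrite in_setD (upper_closure_up pU (ltW pr)) andbT.
by apply/negP => rI; have := upper_closure_not_below pU pI rI; rewrite pr.
Qed.

Lemma adj2I I J K : po_set I != set0 -> po_set J != set0 ->
  [disjoint I & J] ->
  (forall p q, p \in po_set I -> q \in po_set J -> ~~ (q < p)%O) ->
  po_set K = I :|: J -> adj2 I J K.
Proof.
move=> I0 J0 IJ IJle KE.
have prIJ : precedes I J.
  rewrite /precedes IJ; apply/forall_inP => p pI.
  by apply/forall_inP => q; exact: IJle.
rewrite /adj2 /adjacent /= I0 J0 prIJ !big_cons big_nil setU0 -KE eqxx.
by rewrite (valP I) (valP J) (valP K).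
Qed.

End UpperClosure.

Section CompatibleFamily.
Variables (R : pzRingType) (d : Order.disp_t) (P : finPOrderType d).
Variables (C C' : P -> int -> lmodType R) (k : int).
Variable S : forall I : po_interval P, {linear dsum C I k -> dsum C' I k}.
Hypothesis S_i : forall I J IJ : po_interval P, adj2 I J IJ -> forall x,
  S IJ (res C I IJ k x) = res C' I IJ k (S I x).
Hypothesis S_p : forall I J IJ : po_interval P, adj2 I J IJ -> forall x,
  S J (res C IJ J k x) = res C' IJ J k (S IJ x).

(* Adjacency requires nonempty intervals, so the degenerate cases [I = set0],
   [U = I] and [U = setT] are treated apart. *)
Lemma block_compatible (I : po_interval P) x :
  block (S (po_full P)) I I x = S I x.
Proof.
have [I0|I0] := eqVneq (po_set I) set0.
  (* A direct sum over the empty set has only one element. *)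
  by apply: coordP => p pI; have := in_set0 p; rewrite -I0 pI.
pose U := PoInterval (upper_closure_interval I).
have IU : po_set I \subset po_set U := sub_upper_closure I.
have UT : S U (res C [set: P] U k (res C I [set: P] k x)) =
    res C' [set: P] U k (S (po_full P) (res C I [set: P] k x)).
  (* The complement [A] is a down-set, so [(A, U)] is adjacent with union [P] once [A] is nonempty,
     and [S_p] applies. *)
  pose A := PoInterval (upper_closure_setC_interval I).
  have [A0|A0] := eqVneq (po_set A) set0.
    have -> : U = po_full P.
      by apply: val_inj; apply: setC_inj; rewrite setCT; exact: A0.
    by rewrite !res_id.
  apply: (@S_p A U (po_full P)); apply: adj2I => //=.
  - by apply: contra I0 => /eqP U0; rewrite -subset0 -U0.
  - by rewrite -setI_eq0 setIC setICr.
  - move=> p q; rewrite in_setC => pU qU; apply: contra pU => /ltW.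
    exact: upper_closure_up.
  - by rewrite setUC setUCr.
have IUS : S U (res C I U k x) = res C' I U k (S I x).
  (* Likewise [(I, B)] is adjacent with union [U], and [S_i] applies. *)
  pose B := PoInterval (upper_closure_setD_interval I).
  have [B0|B0] := eqVneq (po_set B) set0.
    have -> : U = I.
      apply: val_inj; apply/eqP; rewrite eqEsubset [X in _ && X]IU andbT.
      by rewrite -setD_eq0; apply/eqP.
    by rewrite !res_id.
  apply: (@S_i I B U); apply: adj2I => //=.
  - by apply/pred0P => p /=; rewrite in_setD; case: (p \in po_set I).
  - by move=> p q pI /setDP[qU qI]; exact: upper_closure_not_below qU qI pI.
  - by rewrite -[LHS](setID _ I) (setIidPr (sub_upper_closure I)).
(* The final restriction to [I] factors through [U]: [UT] moves [S] from [P] to [U], then [IUS]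
   moves it from [U] to [I]. *)
rewrite -[LHS]/(res C' setT I k (S (po_full P) (res C I setT k x))).
rewrite -(@res_res _ _ C' setT U I) ?setTI // -UT res_res ?subsetT // IUS.
by rewrite res_res ?res_id // setIid.
Qed.

End CompatibleFamily.

Section TrivialClass.
Variables (R : pzRingType) (d : Order.disp_t) (P : finPOrderType d).
Variables (C : P -> int -> lmodType R) (D : boundary_map C).
Hypothesis D0 : trivial_boundary D.

Lemma cclass_trivial (A : {set P}) k z :
  cclass D A k z = trivial_class D0 A k (cycle_val z).
Proof. by apply: (congr1 (cclass D A k)); exact: val_inj. Qed.

(** The extension by zero of [x] is itself a cycle, and it represents the image class. *)
Lemma ci_trivial (I J IJ : po_interval P) (a : adj2 I J IJ) k x :
  ci D a k (trivial_class D0 I k x) = trivial_class D0 IJ k (res C I IJ k x).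
Proof. exact: ci_class. Qed.

Lemma cp_trivial (I J IJ : po_interval P) (a : adj2 I J IJ) k x :
  cp D a k (trivial_class D0 IJ k x) = trivial_class D0 J k (res C IJ J k x).
Proof. exact: cp_class. Qed.

End TrivialClass.

Theorem theorem3p1 (R : pzRingType) (d : Order.disp_t) (P : finPOrderType d)
    (C C' : P -> int -> lmodType R)
    (D : boundary_map C) (D' : boundary_map C')
    (G G' : graded_module_braid R P)
    (D_conn : connection_matrix D G) (D'_conn : connection_matrix D' G')
    (D_trivial : trivial_boundary D) (D'_trivial : trivial_boundary D')
    (Phi : braid_map (chain_homology_braid D) G) (Phi_iso : braid_iso Phi)
    (Phi' : braid_map (chain_homology_braid D') G') (Phi'_iso : braid_iso Phi')
    (Theta : braid_map G G') (Theta_iso : braid_iso Theta) :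
  transition_matrix D D' G G' (fun k : int =>
    linv (trivial_class_bij D'_trivial [set: P] k)
    \o linv (Phi'_iso (po_full P) k)
    \o Theta (po_full P) k
    \o Phi (po_full P) k
    \o trivial_class D_trivial [set: P] k).
Proof.
(* The formula for [T], taken at every interval; [T] is the case [po_full P]. *)
pose S k (I : po_interval P) : {linear dsum C I k -> dsum C' I k} :=
  linv (trivial_class_bij D'_trivial I k) \o linv (Phi'_iso I k)
  \o Theta I k \o Phi I k \o trivial_class D_trivial I k.
have SE k I x : Phi' I k (trivial_class D'_trivial I k (S k I x)) =
    Theta I k (Phi I k (trivial_class D_trivial I k x)).
  exact: etrans (congr1 (Phi' I k) (linvK _ _)) (linvK _ _).
(* Identities between values of [S] are checked in [G'], where [SE] eliminates the inverses. *)
have inj k I : injective (fun y => Phi' I k (trivial_class D'_trivial I k y)).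
  apply: inj_comp; first exact: bij_inj (Phi'_iso I k).
  exact: bij_inj (trivial_class_bij D'_trivial I k).
have Si k (I J IJ : po_interval P) : adj2 I J IJ -> forall x,
    S k IJ (res C I IJ k x) = res C' I IJ k (S k I x).
  move=> a x; apply: inj.
  rewrite SE -!(ci_trivial _ a).
  rewrite [in LHS](braid_fun_i Phi a) braid_fun_i -SE.
  by rewrite [in RHS](braid_fun_i Phi' a).
have Sp k (I J IJ : po_interval P) : adj2 I J IJ -> forall x,
    S k J (res C IJ J k x) = res C' IJ J k (S k IJ x).
  move=> a x; apply: inj.
  rewrite SE -!(cp_trivial _ a).
  rewrite [in LHS](braid_fun_p Phi a) braid_fun_p -SE.
  by rewrite [in RHS](braid_fun_p Phi' a).
have SB k := block_compatible (@Si k) (@Sp k).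
have T_chain (I : po_interval P) :
    chain_map D D' (fun k => block (S k (po_full P)) I I).
  (* Both differentials vanish, so both sides are zero. *)
  by move=> k l e x; rewrite !trivial_cdiff // linear0.
apply: (TransitionMatrix (tm_chain := T_chain)).
- by move=> I J IJ a k x; rewrite !SB; exact: Si a x.
- by move=> I J IJ a k x; rewrite !SB; exact: Sp a x.
exists Theta, Phi, Phi'; split=> // I k x.
(* On the class of a cycle [z] the induced map applies the block of [T] to [z]; by [SB] this is
   [S k I], and [SE] is then the covering identity. *)
have [z <-] := cclass_surj x; rewrite [chain_map_homology _ _ _]homology_mapE.
rewrite (cclass_trivial D_trivial) -SE -SB; congr (Phi' I k _).
exact: cclass_trivial.
Qed.
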